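(* Let $w$ be an Arnoux-Rauzy word. Then the vector of letter frequencies $f_w=(f_w(1),f_w(2),f_w(3))$ of $w$ has rationally independent entries, i.e. $f_w(1),f_w(2),f_w(3)$ are linearly independent over $\mathbb{Q}$.
   Context: Let $A=\{1,2,3\}$, let $A^*$ be the set of finite words over $A$ and $A^{\mathbb{N}}$ the set of infinite words ($\mathbb{N}=\{0,1,2,\dots\}$). A finite word $u=u[0]\cdots u[n-1]$ is a factor of a (finite or infinite) word $w$ if there is $i\ge 0$ with $w[i+k]=u[k]$ for all $0\le k\le n-1$; if one can take $i=0$, $u$ is the prefix of length $n$ of $w$, denoted $p_n(w)$. Arnoux-Rauzy words. For $i\in A$ the Arnoux-Rauzy substitution $\sigma_i: A\to A^*$ is $\sigma_i(i)=i$, $\sigma_i(j)=ij$ for $j\in A\setminus\{i\}$, extended to a morphism for concatenation on $A^*$ and on $A^{\mathbb{N}}$. A sequence of finite words $(u_n)$ converges to an infinite word $w$ if for every sequence $(v_n)$ of infinite words, $u_n\cdot v_n$ converges to $w$ for the distance $\delta(x,y)=2^{-\min\{n: x[n]\ne y[n]\}}$ (and $\delta(x,x)=0$). If $(s_n)_{n\in\mathbb{N}}\in\{\sigma_1,\sigma_2,\sigma_3\}^{\mathbb{N}}$ contains infinitely many occurrences of each of $\sigma_1,\sigma_2,\sigma_3$, then for $\alpha\in A$ the sequence of finite words $s_0\circ\cdots\circ s_{n-1}(\alpha)$ converges to an infinite word $w_0$ not depending on $\alpha$; the words $w_0$ so obtained are the standard Arnoux-Rauzy words. An infinite word over $A$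 is an Arnoux-Rauzy word if it has the same set of factors as some standard Arnoux-Rauzy word. Letter frequencies. For $\alpha\in A$, $f_w(\alpha)=\lim_{n\to\infty}|p_n(w)|_\alpha/n$, where $|u|_\alpha$ is the number of occurrences of $\alpha$ in $u$; these limits exist for every Arnoux-Rauzy word. *)

(* Defs.v *)
From HB Require Import structures.
From mathcomp Require Import all_boot all_order all_algebra.
From mathcomp Require Import all_classical all_reals all_analysis.
Set Implicit Arguments.
Unset Strict Implicit.
Unset Printing Implicit Defensive.
Import Order.TTheory GRing.Theory Num.Theory.
Import numFieldNormedType.Exports.
Local Open Scope classical_set_scope.
Local Open Scope ring_scope.

(* The alphabet {1,2,3} is encoded as 'I_3 = {0,1,2}. *)
Definition letter := 'I_3.
Definition word := seq letter.
Definition infword := nat -> letter.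

(* [ord0] is a default value for [nth], never reached since k < size u. *)
Definition factor (u : word) (w : infword) : Prop :=
  exists i : nat, forall k : nat, (k < size u)%N -> w (i + k)%N = nth ord0 u k.

Definition prefix_of (n : nat) (w : infword) : word := mkseq w n.

Definition infcat (u : word) (v : infword) : infword :=
  fun n => if (n < size u)%N then nth ord0 u n else v (n - size u)%N.

Definition sigma (i : letter) (j : letter) : word :=
  if j == i then [:: i] else [:: i; j].

Definition morph (s : letter -> word) (u : word) : word := flatten (map s u).

(* [directed d n u] is s_0 o ... o s_(n-1) (u) with s_k = sigma (d k): the
   substitution of index n-1 is applied first. *)
Definition directed (d : nat -> letter) (n : nat) (u : word) : word :=
  foldr (fun i => morph (sigma i)) u (mkseq d n).

Definition word_dist (R : realType) (x y : infword) : R :=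
  if pselect (exists n, x n != y n) is left h then 2^-1 ^+ ex_minn h else 0.

Definition words_cvg (R : realType) (u : nat -> word) (w : infword) : Prop :=
  forall v : nat -> infword,
    (fun n => word_dist R (infcat (u n) (v n)) w) @ \oo --> (0 : R).

Definition standard_arnoux_rauzy (R : realType) (w0 : infword) : Prop :=
  exists d : nat -> letter,
    (forall i : letter, infinite_set [set n | d n = i]) /\
    (forall a : letter, words_cvg R (fun n => directed d n [:: a]) w0).

Definition arnoux_rauzy (R : realType) (w : infword) : Prop :=
  exists w0 : infword, standard_arnoux_rauzy R w0 /\
    (forall u : word, factor u w <-> factor u w0).

(* The term of index n = 0 is 0 / 0 = 0, which does not affect the limit. *)
Definition freq (R : realType) (w : infword) (a : letter) : R :=
  limn (fun n => (count_mem a (prefix_of n w))%:R / n%:R : R).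

Definition rationally_independent (R : realType) (n : nat) (v : 'I_n -> R) :
    Prop :=
  forall q : 'I_n -> rat, \sum_(i < n) ratr (q i) * v i = 0 ->
    forall i, q i = 0.

(* Main.v *)
(** Write W_n(c) = s_0 o ... o s_(n-1) (c). For q : letter -> K, the values
    q_n(c) = sum of q over the letters of W_n(c) satisfy q_(n+1) = dual_step (d n) q_n:
    the entry at i = d n is kept and added to the two others. While q_n has
    entries of both signs (zero allowed), its spread max - min does not increase
    and bounds its entries.

    Frequencies: take q(c) = [c = a] - x, of spread 1, with x the frequency of a in
    W_N(b). Then q_N(b) = 0, so q_n has both signs for n <= N and
    | |W_n(c)|_a - x |W_n(c)| | <= 1. Letting N grow gives a frequency of a with
    discrepancy at most 1 on every W_n(c), hence o(N) on factors of length N.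

    Independence: an integer relation q between the frequencies has bounded
    q_n. If q is nonzero, every q_n has a negative and a positive entry,
    because a nonzero nonnegative vector grows without bound. Say exactly one
    entry of q_n is negative (otherwise negate q). It stays the only negative one until
    its letter is chosen, and then the spread strictly drops; this cannot
    happen infinitely often. *)
Require Import Defs.
From mathcomp Require Import all_boot all_order all_algebra.
From mathcomp Require Import all_classical all_reals all_analysis.
From mathcomp Require Import zify ring lra.

Set Implicit Arguments.
Unset Strict Implicit.
Unset Printing Implicit Defensive.
Import Order.TTheory GRing.Theory Num.Theory.
Import numFieldNormedType.Exports.
Local Open Scope classical_set_scope.
Local Open Scope ring_scope.

(** * Weights of words and the dual action of the substitutions *)

Definition weight (V : nmodType) (q : letter -> V) (u : word) : V :=
  \sum_(x <- u) q x.

(** The transpose of the incidence matrix of [sigma i]. Transposing reverses the order: in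
    [dual_orbit] the outermost substitution, of index 0, acts first. *)
Definition dual_step (V : nmodType) (i : letter) (q : letter -> V) : letter -> V :=
  fun j => if j == i then q i else q i + q j.

Fixpoint dual_orbit (V : nmodType) (d : nat -> letter) (q : letter -> V) (n : nat) :
    letter -> V :=
  if n is n'.+1 then dual_step (d n') (dual_orbit d q n') else q.

Lemma weight_cat (V : nmodType) (q : letter -> V) (u v : word) :
  weight q (u ++ v) = weight q u + weight q v.
Proof. exact: big_cat. Qed.

Lemma weight_morph_sigma (V : nmodType) (q : letter -> V) (i : letter) (u : word) :
  weight q (morph (sigma i) u) = weight (dual_step i q) u.
Proof.
elim: u => [|x u IHu]; first by rewrite /weight !big_nil.
rewrite /morph /= weight_cat -/(morph _ _) IHu /weight big_cons; congr (_ + _).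
by rewrite /sigma /dual_step; case: eqP => _; rewrite !big_cons big_nil addr0.
Qed.

Lemma directedS (d : nat -> letter) (n : nat) (u : word) :
  directed d n.+1 u = directed d n (morph (sigma (d n)) u).
Proof. by rewrite /directed mkseqS foldr_rcons. Qed.

Lemma weight_directed (V : nmodType) (q : letter -> V) d n u :
  weight q (directed d n u) = weight (dual_orbit d q n) u.
Proof.
elim: n u => [//|n IHn] u.
by rewrite directedS IHn weight_morph_sigma.
Qed.

Lemma weight_directed1 (V : nmodType) (q : letter -> V) d n c :
  weight q (directed d n [:: c]) = dual_orbit d q n c.
Proof. by rewrite weight_directed /weight big_seq1. Qed.

Lemma dual_orbitN (V : zmodType) d (q : letter -> V) n x :
  dual_orbit d (fun y => - q y) n x = - dual_orbit d q n x.
Proof.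
elim: n x => [//|n IHn] x /=.
by rewrite /dual_step; case: ifP; rewrite !IHn // opprD.
Qed.

(** * Signs and spread along an orbit *)

Section Spread.
Context {K : realDomainType} (d : nat -> letter).
Implicit Types (q : letter -> K) (D : K).

Lemma dual_step_gt0 i q : (forall x, 0 < q x) -> forall x, 0 < dual_step i q x.
Proof.
by move=> q0 x; rewrite /dual_step; case: ifP => // _; rewrite addr_gt0.
Qed.

Lemma dual_orbit_gt0 q m n : (m <= n)%N ->
  (forall x, 0 < dual_orbit d q m x) -> forall x, 0 < dual_orbit d q n x.
Proof.
move=> /subnKC <- q0; elim: (n - m)%N => [|k IHk]; first by rewrite addn0.
by rewrite addnS; exact: dual_step_gt0.
Qed.

(** The sign hypotheses place every entry between -D and D. A new difference is an old one, zero,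
    or, when exactly one of [x], [y] is [i], an old entry up to sign. *)
Lemma dual_step_spread i q D :
  (exists x, q x <= 0) -> (exists y, 0 <= q y) ->
  (forall x y, q x - q y <= D) ->
  forall x y, dual_step i q x - dual_step i q y <= D.
Proof.
move=> [x0 qx0] [y0 qy0] qD x y.
have qle z : q z <= D by have := qD z x0; lra.
have qge z : - q z <= D by have := qD y0 z; lra.
have D0 : 0 <= D by have := qD x0 x0; lra.
rewrite /dual_step; case: ifP => _; case: ifP => _.
- by have := qD x y; lra.
- by have := qge y; lra.
- by have := qle x; lra.
- by have := qD x y; lra.
Qed.

(** Strict positivity of all entries propagates forward in time, so one nonpositive entry at time
    [N] excludes it at every earlier time. *)
Lemma dual_orbit_le0 q N b n : (n <= N)%N -> dual_orbit d q N b <= 0 ->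
  exists x, dual_orbit d q n x <= 0.
Proof.
move=> nN qNb; apply: contrapT => /forallNP q0.
have /(dual_orbit_gt0 nN)/(_ b) : forall x, 0 < dual_orbit d q n x.
  by move=> x; rewrite ltNge; apply/negP/q0.
by rewrite ltNge qNb.
Qed.

Lemma dual_orbit_ge0 q N b n : (n <= N)%N -> 0 <= dual_orbit d q N b ->
  exists x, 0 <= dual_orbit d q n x.
Proof.
move=> nN qNb; have [] := @dual_orbit_le0 (fun y => - q y) N b n nN.
  by rewrite dual_orbitN oppr_le0.
by move=> x; rewrite dual_orbitN oppr_le0; exists x.
Qed.

Lemma dual_orbit_bound q D N b n :
  (forall x y, q x - q y <= D) -> dual_orbit d q N b = 0 -> (n <= N)%N ->
  forall x, `|dual_orbit d q n x| <= D.
Proof.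
move=> qD qNb nN x.
(* The entry at [b], being zero at time [N], serves for both signs. *)
have le0 k : (k <= N)%N -> exists y, dual_orbit d q k y <= 0.
  by move=> kN; apply: (dual_orbit_le0 kN (b := b)); rewrite qNb.
have ge0 k : (k <= N)%N -> exists y, 0 <= dual_orbit d q k y.
  by move=> kN; apply: (dual_orbit_ge0 kN (b := b)); rewrite qNb.
have spread : forall y z, dual_orbit d q n y - dual_orbit d q n z <= D.
  elim: n nN {x} => [//|n IHn] nN.
  apply: dual_step_spread; [exact/le0/ltnW|exact/ge0/ltnW|exact/IHn/ltnW].
have [y qy] := le0 _ nN; have [z qz] := ge0 _ nN.
rewrite ler_norml; have := spread x y; have := spread z x; lra.
Qed.

End Spread.

(** * Integer orbits when every letter is chosen infinitely often *)

Section IntegerOrbits.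
Variable d : nat -> letter.
Hypothesis d_recurrent : forall i n, exists2 k, (n <= k)%N & d k = i.
Implicit Types (q : letter -> int).

Lemma dual_orbit_mono q m n : (forall x, 0 <= dual_orbit d q m x) -> (m <= n)%N ->
  forall x, dual_orbit d q m x <= dual_orbit d q n x.
Proof.
move=> q0 /subnKC <-; elim: (n - m)%N => [|k IHk] x; first by rewrite addn0.
rewrite addnS /= /dual_step; case: eqP => [->//|_].
by have := IHk x; have := IHk (d (m + k)); have := q0 (d (m + k)); lia.
Qed.

(** The entry at [j] is still positive when [j] is next chosen, and is then added to all the
    others. *)
Lemma dual_orbit_eventually_gt0 q m j : (forall x, 0 <= dual_orbit d q m x) ->
  0 < dual_orbit d q m j -> exists n, forall x, 0 < dual_orbit d q n x.
Proof.
move=> q0 qj; have [k mk dk] := d_recurrent j m.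
exists k.+1 => x /=; have mono := dual_orbit_mono q0 mk.
have := mono x; have := mono j; have := q0 x.
by rewrite /dual_step dk; case: ifP => _; lia.
Qed.

Lemma dual_orbit_grows q m (B : nat) : (forall x, 0 < dual_orbit d q m x) ->
  exists N, forall n, (N <= n)%N -> forall x, B%:Z <= dual_orbit d q n x.
Proof.
move=> q0; have qm0 x : 0 <= dual_orbit d q m x by exact: ltW.
suff [N mN BN] : exists2 N, (m <= N)%N & forall x, B%:Z <= dual_orbit d q N x.
  exists N => n Nn x; apply: le_trans (BN x) _; apply: dual_orbit_mono => // y.
  exact: le_trans (BN y).
elim: B => [|B [N mN BN]]; first by exists m.
have gt0 n : (m <= n)%N -> forall x, 0 < dual_orbit d q n x.
  by move=> mn; exact: dual_orbit_gt0 mn q0.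
(* Choosing [i] raises every other entry by at least 1. *)
have grow i n : (N <= n)%N -> d n = i -> forall k, (n < k)%N ->
    forall x, x != i -> B.+1%:Z <= dual_orbit d q k x.
  move=> Nn dn k nk x xi.
  have mn := leq_trans mN Nn.
  have := @dual_orbit_mono q n.+1 k _ nk x.
  rewrite /= /dual_step dn (negbTE xi) -dn.
  have := @dual_orbit_mono q N n (fun y => ltW (gt0 N mN y)) Nn x.
  have := BN x; have := gt0 n mn (d n).
  move=> ? ? ? /(_ _); have : forall y, 0 <= dual_orbit d q n.+1 y.
    by move=> y; apply/ltW/gt0; lia.
  move=> /[swap] /[apply]; lia.
(* Two distinct letters chosen in turn suffice: each entry is raised by at least one of the two
   choices. *)
have [k Nk dk] := d_recurrent ord0 N.
have [l kl dl] := d_recurrent ord_max k.+1.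
exists l.+1; first by lia.
move=> x; have [->|x0] := eqVneq x ord0.
  by apply: (grow _ _ _ dl) => //; lia.
by apply: (grow _ _ Nk dk) => //; lia.
Qed.

(** With the entry at [m] at most -1 and spread at most D + 1, the other entries lie between 0 and
    D. Choosing [m] then makes every difference at most D, against the second hypothesis. The
    induction is on the waiting time [k] before [m] is chosen. *)
Lemma dual_orbit_neg_letter_absurd q (D : nat) (m : letter) :
  (forall n, exists x, dual_orbit d q n x < 0) ->
  (forall n, ~ forall x y, dual_orbit d q n x - dual_orbit d q n y <= D%:Z) ->
  forall n,
  dual_orbit d q n m < 0 -> (forall x, x != m -> 0 <= dual_orbit d q n x) ->
  ~ forall x y, dual_orbit d q n x - dual_orbit d q n y <= D.+1%:Z.
Proof.
move=> neg IH n; have [k nk dk] := d_recurrent m n.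
rewrite -(subnK nk) in dk; move: (k - n)%N dk => {nk}k.
elim: k n => [|k IHk] n dk qm qx qD.
  apply: (IH n.+1) => x y; rewrite /= -[n]add0n dk add0n /dual_step.
  have := qD x m; have := qD y m; have := qD x y; have := qD m y.
  by case: eqVneq => [->|/qx]; case: eqVneq => [->|/qx]; lia.
have [dn|dn] := eqVneq (d n) m.
  apply: (IH n.+1) => x y; rewrite /= dn /dual_step.
  have := qD x m; have := qD y m; have := qD x y; have := qD m y.
  by case: eqVneq => [->|/qx]; case: eqVneq => [->|/qx]; lia.
have qx' x : x != m -> 0 <= dual_orbit d q n.+1 x.
  by move=> /qx ? /=; rewrite /dual_step; have := qx _ dn; case: ifP; lia.
apply: (IHk n.+1); rewrite ?addnS -?addSn //.
(* Some entry is negative at the next time, and it can only be that of [m]. *)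
- have [x] := neg n.+1; have [->//|/qx'] := eqVneq x m; lia.
- apply: dual_step_spread => //; first by exists m; exact: ltW.
  by exists (d n); exact: qx.
Qed.

Lemma letter3 (x y z : letter) : x != y -> y != z -> x != z ->
  forall t, [\/ t = x, t = y | t = z].
Proof.
rewrite -!val_eqE /= => xy yz xz t.
have [E|[E|E]] : t = x :> nat \/ t = y :> nat \/ t = z :> nat.
  have := ltn_ord x; have := ltn_ord y; have := ltn_ord z; have := ltn_ord t; lia.
- by constructor 1; exact: val_inj.
- by constructor 2; exact: val_inj.
- by constructor 3; exact: val_inj.
Qed.

Lemma dual_orbit_signs_absurd q :
  (forall n, exists x, dual_orbit d q n x < 0) ->
  (forall n, exists x, 0 < dual_orbit d q n x) -> False.
Proof.
suff main (D : nat) : forall q,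
  (forall n, exists x, dual_orbit d q n x < 0) ->
  (forall n, exists x, 0 < dual_orbit d q n x) ->
  forall n, ~ forall x y, dual_orbit d q n x - dual_orbit d q n y <= D%:Z.
  move=> neg pos.
  pose M := \sum_x `|q x|%N; apply: (main (M + M)%N q neg pos 0%N) => x y /=.
  have le z : (`|q z| <= M)%N by rewrite /M (bigD1 z) //= leq_addr.
  have := le x; have := le y; lia.
elim: D => [|D IHD] {}q neg pos n qD.
  have [x qx] := neg n; have [y qy] := pos n; have := qD y x; lia.
have [x qx] := neg n; have [y qy] := pos n.
have xy : x != y by apply: contraTneq qx => ->; lia.
have [z /andP[zx zy]] : exists z, (z != x) && (z != y).
  have : #|[set: 'I_3] :\: [set x; y]|%SET != 0%N.
    rewrite cardsD finset.setTI cardsT card_ord cards2 xy //.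
  rewrite cards_eq0 => /set0Pn[z]; rewrite !inE negb_or andbT => ?.
  by exists z.
have xz : x != z by rewrite eq_sym.
have yz : y != z by rewrite eq_sym.
(* Either [x] is the only negative letter, or [y] is the only positive one and the vector is
   negated; hence the quantification over [q] in [main]. *)
have [z0|z0] := lerP 0 (dual_orbit d q n z).
- apply: (@dual_orbit_neg_letter_absurd q D x neg (IHD q neg pos) n) => // t tx.
  by have [te|->|->] := letter3 xy yz xz t; [rewrite te eqxx in tx|lia|].
- have neg' m : exists t, dual_orbit d (fun u => - q u) m t < 0.
    by have [t ?] := pos m; exists t; rewrite dual_orbitN oppr_lt0.
  have pos' m : exists t, 0 < dual_orbit d (fun u => - q u) m t.
    by have [t ?] := neg m; exists t; rewrite dual_orbitN oppr_gt0.
  apply: (@dual_orbit_neg_letter_absurd _ D y neg' (IHD _ neg' pos') n).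
  + by rewrite dual_orbitN oppr_lt0.
  + move=> t ty; rewrite dual_orbitN oppr_ge0.
    by have [->|te|->] := letter3 xy yz xz t; [exact: ltW| |exact: ltW];
      rewrite te eqxx in ty.
  + by move=> s t; rewrite !dual_orbitN opprK addrC; exact: qD.
Qed.

(** Each [dual_step] is invertible: the chosen entry is kept and can be subtracted from the
    others. *)
Lemma dual_orbit_inj0 q n : (forall x, dual_orbit d q n x = 0) -> forall x, q x = 0.
Proof.
elim: n => [//|n IHn] q0; apply: IHn => x.
have qdn : dual_orbit d q n (d n) = 0.
  by have := q0 (d n); rewrite /= /dual_step eqxx.
by have := q0 x; rewrite /= /dual_step qdn; case: eqP => [->|_] //; rewrite add0r.
Qed.

Lemma dual_orbit_lt0 q (B : nat) : (forall n x, dual_orbit d q n x <= B%:Z) ->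
  forall n, (exists x, dual_orbit d q n x != 0) -> exists x, dual_orbit d q n x < 0.
Proof.
move=> qB n [j qj]; apply: contrapT => /forallNP nneg.
have q0 x : 0 <= dual_orbit d q n x by rewrite leNgt; exact/negP/nneg.
have qj0 : 0 < dual_orbit d q n j by rewrite lt_def qj q0.
have [m qm] := dual_orbit_eventually_gt0 q0 qj0.
have [N /(_ N (leqnn N) ord0)] := dual_orbit_grows B.+1 qm.
by have := qB N ord0; lia.
Qed.

Lemma bounded_dual_orbit_eq0 q (B : nat) :
  (forall n x, `|dual_orbit d q n x| <= B%:Z) -> forall x, q x = 0.
Proof.
move=> qB; apply: contrapT => /existsNP[j /eqP qj].
have neq0 n : exists x, dual_orbit d q n x != 0.
  apply: contrapT => /forallNP q0; move/eqP: qj; apply.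
  by apply: (@dual_orbit_inj0 q n) => x; apply/eqP/negPn/negP/q0.
apply: (@dual_orbit_signs_absurd q) => n.
  by apply: dual_orbit_lt0 => // {}n x; exact: le_trans (ler_norm _) (qB n x).
have [||x] := @dual_orbit_lt0 (fun x => - q x) B _ n.
- move=> m x; have := qB m x; rewrite dual_orbitN ler_norml => /andP[+ _].
  by rewrite lerNl.
- by have [x qx] := neq0 n; exists x; rewrite dual_orbitN oppr_eq0.
- by rewrite dual_orbitN oppr_lt0 => ?; exists x.
Qed.

(** Lengths are weights for the constant vector 1, whose orbit is positive from the start. *)
Lemma size_directed_grows (B : nat) : exists N, forall n, (N <= n)%N ->
  forall c, (B <= size (directed d n [:: c]))%N.
Proof.
have [N HN] := @dual_orbit_grows (fun=> 1) 0 B (fun=> ltr01).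
exists N => n Nn c; have := HN n Nn c; rewrite -weight_directed1 /weight.
by rewrite big_const_seq count_predT -Monoid.iteropE -/(GRing.natmul _ _) natz; lia.
Qed.

End IntegerOrbits.

(** * Block decomposition of the directed words *)

Lemma size_directed_gt0 d n c : (0 < size (directed d n [:: c]))%N.
Proof.
rewrite lt0n size_eq0; apply/eqP => E.
have := @dual_orbit_gt0 int d (fun=> 1) 0 n (leq0n n) (fun=> ltr01) c.
by rewrite -weight_directed1 E /weight big_nil ltxx.
Qed.

Lemma morph_cat (s : letter -> word) (u v : word) :
  morph s (u ++ v) = morph s u ++ morph s v.
Proof. by rewrite /morph map_cat flatten_cat. Qed.

Lemma directed_cat d n u v : directed d n (u ++ v) = directed d n u ++ directed d n v.
Proof.
by elim: n u v => [//|n IHn] u v; rewrite !directedS morph_cat IHn.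
Qed.

Lemma directed_morph d n u : directed d n u = morph (fun c => directed d n [:: c]) u.
Proof.
elim: u => [|c u IHu]; last by rewrite -cat1s directed_cat IHu.
by elim: n => [//|n IHn]; rewrite directedS.
Qed.

(** Together with [directed_morph], this cuts a word of any level [n] above [m] into blocks
    W_m(c). *)
Lemma directed_split d m n u : (m <= n)%N -> exists z, directed d n u = directed d m z.
Proof.
move=> /subnKC <-; elim: (n - m)%N u => [|k IHk] u; first by exists u; rewrite addn0.
by rewrite addnS directedS; exact: IHk.
Qed.

(** * Discrepancy of factors *)

Section Discrepancy.
Variable R : realType.
Implicit Types (g : letter -> R) (a c : letter) (x : R) (u z : word).

Definition centered a x : letter -> R := fun c => (c == a)%:R - x.

Lemma weight_centered a x u :
  weight (centered a x) u = (count_mem a u)%:R - x * (size u)%:R.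
Proof.
elim: u => [|c u IHu]; first by rewrite /weight big_nil /= mulr0 subr0.
rewrite -cat1s weight_cat IHu /weight big_seq1 /centered /= natrD.
rewrite -[(size u).+1]addn1 natrD.
by ring.
Qed.

Lemma weight_le_size g u : (forall c, `|g c| <= 1) -> `|weight g u| <= (size u)%:R.
Proof.
move=> g1; elim: u => [|c u IHu]; first by rewrite /weight big_nil normr0.
rewrite -cat1s weight_cat /= -[(size u).+1]addn1 natrD addrC.
by rewrite (le_trans (ler_normD _ _)) // lerD // /weight big_seq1.
Qed.

Section Morph.
Variables (g : letter -> R) (s : letter -> word) (l L : nat).
Hypotheses (l_gt0 : (0 < l)%N) (s_size : forall c, (l <= size (s c) <= L)%N).
Hypotheses (g_le1 : forall c, `|g c| <= 1) (gs_le1 : forall c, `|weight g (s c)| <= 1).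

(** Each whole block costs at most 1 and uses at least [l] letters, so whole blocks cost at most t /
    l in total; the block cut by the end costs at most [L]. *)
Lemma weight_take_morph z t : `|weight g (take t (morph s z))| <= L%:R + t%:R / l%:R.
Proof.
have l0 : 0 < l%:R :> R by rewrite ltr0n.
elim: z t => [|c z IHz] t.
  by rewrite /weight big_nil normr0 addr_ge0 // divr_ge0.
rewrite [morph _ _]/= take_cat; have /andP[lc cL] := s_size c.
case: ltnP => [tc|ct].
  apply: le_trans (weight_le_size _ g_le1) _.
  rewrite -[leLHS]addr0 lerD ?divr_ge0 // ler_nat size_take_min.
  exact: leq_trans (geq_minr _ _) cL.
rewrite weight_cat; apply: le_trans (ler_normD _ _) _.
apply: le_trans (lerD (gs_le1 c) (IHz _)) _.
rewrite addrCA lerD2l -[X in X + _](divff (lt0r_neq0 l0)) -mulrDl.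
by rewrite ler_pM2r ?invr_gt0 // -natrD ler_nat; lia.
Qed.

(** The factor may also start inside a block, which costs another [L]. *)
Lemma weight_infix_morph z k t :
  `|weight g (take t (drop k (morph s z)))| <= (2 * L)%:R + t%:R / l%:R.
Proof.
elim: z k => [|c z IHz] k.
  by rewrite /weight big_nil normr0 addr_ge0 // divr_ge0.
rewrite [morph _ _]/= drop_cat; have /andP[lc cL] := s_size c.
case: ltnP => [kc|_]; last exact: IHz.
have le1 v : (size v <= L)%N -> `|weight g v| <= L%:R.
  by move=> vL; apply: le_trans (weight_le_size _ g_le1) _; rewrite ler_nat.
have dc : (size (drop k (s c)) <= L)%N by rewrite size_drop; lia.
rewrite take_cat; case: ltnP => _.
  apply: le_trans (le1 _ _) _; first by rewrite size_take_min; lia.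
  by rewrite -[leLHS]addr0 lerD ?divr_ge0 // ler_nat; lia.
rewrite weight_cat; apply: le_trans (ler_normD _ _) _.
apply: le_trans (lerD (le1 _ dc) (weight_take_morph _ _)) _.
rewrite addrA mul2n -addnn natrD lerD2l ler_pM2r ?invr_gt0 ?ltr0n // ler_nat; lia.
Qed.

End Morph.

(* The frequency is the supremum of the lower bounds (count - 1) / size: all of
   them lie below all the upper bounds (count + 1) / size, since the frequency
   of [a] in a later word separates any two of them. *)
Lemma exists_letter_frequency d a : exists x : R, forall n c,
  `|weight (centered a x) (directed d n [:: c])| <= 1.
Proof.
pose cnt p := (count_mem a (directed d p.1 [:: p.2]))%:R : R.
pose sz p := (size (directed d p.1 [:: p.2]))%:R : R.
have sz0 p : 0 < sz p by rewrite ltr0n size_directed_gt0.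
have bnd p N : (p.1 <= N)%N ->
    `|cnt p - cnt (N, ord0) / sz (N, ord0) * sz p| <= 1.
  move=> pN; rewrite -weight_centered weight_directed1.
  apply: (dual_orbit_bound (N := N) (b := ord0)) => //.
    move=> y z; rewrite /centered.
    by case: (y == a) (z == a) => [] []; rewrite /=; lra.
  by rewrite -weight_directed1 weight_centered divfK ?subrr // gt_eqF // sz0.
pose low p := (cnt p - 1) / sz p; pose upp p := (cnt p + 1) / sz p.
have low_upp p p' : low p <= upp p'.
  pose N := maxn p.1 p'.1.
  have := bnd p N (leq_maxl _ _); have := bnd p' N (leq_maxr _ _).
  rewrite !ler_norml => /andP[h1 h2] /andP[h3 h4].
  apply: (@le_trans _ _ (cnt (N, ord0) / sz (N, ord0))).
    by rewrite ler_pdivrMr //; lra.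
  by rewrite ler_pdivlMr //; lra.
exists (sup (range low)) => n c; rewrite weight_centered.
have ub p : ubound (range low) (upp p) by move=> _ [p' _ <-].
have lo : low (n, c) <= sup (range low).
  by apply: ub_le_sup; [exists (upp (n, c))|exists (n, c)].
have up : sup (range low) <= upp (n, c).
  by apply: ge_sup => //; exists (low (n, c)), (n, c).
move: lo up; rewrite /low /upp ler_pdivrMr // ler_pdivlMr // => lo up.
rewrite ler_norml -/(cnt (n, c)) -/(sz (n, c)); lra.
Qed.

Lemma word_dist_lt (w w' : infword) n : word_dist R w w' < 2^-1 ^+ n ->
  forall k, (k <= n)%N -> w k = w' k.
Proof.
rewrite /word_dist => + k kn; case: pselect => [h|h]; last first.
  by move=> _; apply/eqP/negPn/negP => ww'; apply: h; exists k.
case: ex_minnP => m _ mmin; rewrite ltr_iXn2l ?invr_gt0 ?invf_lt1 ?ltr1n // => nm.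
by apply/eqP/negPn/negP => /mmin; lia.
Qed.

Lemma words_cvg_factor (U : nat -> word) w0 u m : words_cvg R U w0 ->
  (forall B, exists N, forall n, (N <= n)%N -> (B <= size (U n))%N) ->
  Defs.factor u w0 ->
  exists2 n, (m <= n)%N & exists k, u = take (size u) (drop k (U n)).
Proof.
move=> Uw0 Ugrow [i ui]; have [N HN] := Ugrow (i + size u)%N.
(* Any tails would do: past index [N] the compared positions lie inside [U n]. *)
have := Uw0 (fun _ _ => ord0) => /cvgrPdist_lt/(_ (2^-1 ^+ (i + size u))).
rewrite exprn_gt0 ?invr_gt0 // => /(_ isT)[M _ HM].
pose n := maxn m (maxn N M); exists n; first exact: leq_maxl.
have Nn : (N <= n)%N by rewrite /n; lia.
have Mn : (M <= n)%N by rewrite /n; lia.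
have := HM n Mn; rewrite sub0r normrN => /(le_lt_trans (ler_norm _))/word_dist_lt agree.
have sz := HN n Nn; exists i.
have szu : size (take (size u) (drop i (U n))) = size u.
  by rewrite size_takel // size_drop; lia.
apply: (@eq_from_nth _ ord0) => [|k ku]; first by rewrite szu.
rewrite nth_take // nth_drop -ui // -agree ?leq_add2l 1?ltnW //.
by rewrite /infcat (leq_trans _ sz) ?ltn_add2l.
Qed.

End Discrepancy.

(** * Existence of the letter frequencies *)

Lemma infinite_fibers_recurrent (d : nat -> letter) :
  (forall i, infinite_set [set n | d n = i]) ->
  forall i n, exists2 k, (n <= k)%N & d k = i.
Proof.
move=> dinf i n; apply: contrapT => nk; apply: (dinf i).
apply: sub_finite_set (finite_II n) => k /= dk.
by rewrite ltnNge; apply/negP => ?; apply: nk; exists k.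
Qed.

(** A prefix of [w] of length N is a factor of [w0], hence of a concatenation of blocks W_m(c), all
    of length at least l. Its discrepancy is at most N / l plus a constant depending on l. As l is
    arbitrary this is o(N), so the [x] of [exists_letter_frequency] is the limit. *)
Lemma arnoux_rauzy_freq (R : realType) (w : infword) : arnoux_rauzy R w ->
  exists2 d : nat -> letter, (forall i n, exists2 k, (n <= k)%N & d k = i) &
  forall a n c, `|weight (centered a (freq R w a)) (directed d n [:: c])| <= 1.
Proof.
move=> [w0 [[d [/infinite_fibers_recurrent drec dcvg]] ww0]]; exists d => // a.
have [x xP] := exists_letter_frequency R d a.
suff -> : freq R w a = x by [].
have prefix_bound l : (0 < l)%N -> exists L, forall N,
    `|weight (centered a x) (prefix_of N w)| <= L%:R + N%:R / l%:R.
  move=> l0; have [m /(_ m (leqnn m)) ml] := size_directed_grows drec l.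
  pose L := \max_c size (directed d m [:: c]); exists (2 * L)%N => N.
  have fN : Defs.factor (prefix_of N w) w0.
    apply/ww0; exists 0%N => k; rewrite size_mkseq => kN.
    by rewrite nth_mkseq.
  have [B|n mn [k ->]] := words_cvg_factor m (dcvg ord0) _ fN.
    have [M HM] := size_directed_grows drec B.
    by exists M => n /HM.
  have [z ->] := directed_split d [:: ord0] mn; rewrite directed_morph size_mkseq.
  apply: weight_infix_morph => // c.
    by rewrite ml /L leq_bigmax.
  (* At level 0 the block is the letter [c] itself, so the bound covers single letters. *)
  by have := xP 0%N c; rewrite weight_directed1.
rewrite /freq; apply/cvg_lim => //; apply/cvgrPdist_le => e e0.
(* The error e N is split in two: [l] makes N / l at most e N / 2, and a large N does the same for
   the constant [L]. *)
pose l := (Num.truncn (2 / e)).+1.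
have le : l%:R^-1 <= e / 2.
  rewrite -[leRHS]invrK lef_pV2 ?posrE ?invr_gt0 ?divr_gt0 ?ltr0n // invf_div.
  by rewrite ltW // truncnS_gt.
have [L HL] := prefix_bound l isT.
exists (Num.truncn (2 * L%:R / e)).+1 => //= N Nbig.
have N0 : 0 < N%:R :> R by rewrite ltr0n (leq_trans _ Nbig).
have LN : L%:R <= e / 2 * N%:R.
  have : 2 * L%:R / e <= N%:R.
    by apply: ltW; apply: lt_le_trans (truncnS_gt _) _; rewrite ler_nat.
  by rewrite ler_pdivrMr //; lra.
have := HL N; rewrite weight_centered size_mkseq => HN.
rewrite distrC -[X in `|_ - X|](mulfK (lt0r_neq0 N0)) -mulrBl normrM.
rewrite [`|_^-1|]gtr0_norm ?invr_gt0 // ler_pdivrMr //; apply: le_trans HN _.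
have := ler_wpM2l (ltW N0) le; lra.
Qed.

(** * From a rational relation to a bounded integer orbit *)

Lemma clear_denominators (I : finType) (q : I -> rat) :
  exists D : int, exists2 p : I -> int, D != 0 & forall i, (p i)%:~R = D%:~R * q i.
Proof.
exists (\prod_i denq (q i)), (fun i => numq (q i) * \prod_(j | j != i) denq (q j)).
  by apply/prodf_neq0 => i _; exact: denq_neq0.
move=> i; rewrite [in RHS](bigD1 i) //= !rmorphM /= mulrAC [_ * q i]mulrC.
by rewrite -numqE.
Qed.

(** At each letter x of [u] the relation cancels the terms in [f a], leaving p x. An integer weight
    thus becomes a combination of discrepancies, which are bounded. *)
Lemma weight_int_centered (R : realType) (p : letter -> int) (f : letter -> R) u :
  \sum_a (p a)%:~R * f a = 0 ->
  (weight p u)%:~R = \sum_a (p a)%:~R * weight (centered a (f a)) u.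
Proof.
move=> pf; rewrite /weight rmorph_sum /=.
under [RHS]eq_bigr do rewrite mulr_sumr.
rewrite exchange_big; apply: eq_bigr => x _.
under eq_bigr do rewrite mulrBr.
rewrite sumrB pf subr0 (bigD1 x) //= eqxx mulr1 big1 ?addr0 // => a ax.
by rewrite eq_sym (negbTE ax) mulr0.
Qed.

Theorem theorem2 (R : realType) (w : infword) (hw : arnoux_rauzy R w) :
  rationally_independent (freq R w).
Proof.
move=> q qf; have [d drec bnd] := arnoux_rauzy_freq hw.
have [D [p D0 pq]] := clear_denominators q.
have pf : \sum_a (p a)%:~R * freq R w a = 0.
  transitivity (ratr D%:~R * \sum_(i < 3) ratr (q i) * freq R w i); last first.
    by rewrite qf mulr0.
  rewrite mulr_sumr; apply: eq_bigr => a _.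
  by rewrite mulrA -rmorphM /= -pq ratr_int.
have p0 : forall a, p a = 0.
  (* Each discrepancy is at most 1 in absolute value, so the sum of the absolute values of [p]
     bounds the orbit at all times. *)
  apply: (bounded_dual_orbit_eq0 drec (B := \sum_a `|p a|%N)) => n c.
  rewrite -(ler_int R) intr_norm -weight_directed1 (weight_int_centered _ pf).
  rewrite -pmulrn natr_sum; apply: le_trans (ler_norm_sum _ _ _) _.
  apply: ler_sum => a _; rewrite normrM natr_absz intr_norm.
  by rewrite ler_piMr.
move=> i; have := pq i; rewrite p0 => /esym/eqP.
by rewrite mulf_eq0 intr_eq0 (negbTE D0) => /eqP.
Qed.
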